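(* Let $M$ be a compact finite-dimensional manifold and $f\colon M\to M$ a continuous map. If an observable measure $\mu$ for $f$ is isolated in the set $\mathcal{O}$ of all observable measures for $f$ (i.e. $\mu$ is an isolated point of $\mathcal{O}$ in the weak$^*$ topology), then $\mu$ is an SRB measure for $f$.
   Context: Let $m$ be a Lebesgue measure on $M$, normalized so that $m(M)=1$; $m$ is not assumed to be $f$-invariant. Let $\mathcal{P}$ be the set of all Borel probability measures on $M$, endowed with the weak$^*$ topology, and fix a metric $\mathrm{dist}$ on $\mathcal{P}$ inducing this topology. For $x\in M$, let $p\omega(x)\subset\mathcal{P}$ be the set of all weak$^*$ limits of convergent subsequences of the sequence $\left\{\frac1n\sum_{j=0}^{n-1}\delta_{f^j(x)}\right\}_{n\ge 1}$, where $\delta_y$ is the Dirac probability measure supported at $y$. For $\mu\in\mathcal{P}$, $\mathrm{dist}(p\omega(x),\mu)$ denotes the distance from the point $\mu$ to the set $p\omega(x)$. A measure $\mu\in\mathcal{P}$ is called SRB (or physical) for $f$ if the set $A(\mu)=\{x\in M:\ p\omega(x)=\{\mu\}\}$ has positive Lebesgue measure $m$; the set $A(\mu)$ is called the basin of attraction of $\mu$. A measure $\mu\in\mathcal{P}$ is called observable (or SRB-like) for $f$ if for every $\varepsilon>0$ the set $A_\varepsilon(\mu)=\{x\in M:\ \mathrm{dist}(p\omega(x),\mu)<\varepsilon\}$ has positive Lebesgue measure $m$. The set of all observable measures for $f$ is denoted $\mathcal{O}$. *)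

(* Defs.v *)
From HB Require Import structures.
From mathcomp Require Import all_boot all_order all_algebra.
From mathcomp Require Import all_classical all_reals all_analysis.
Set Implicit Arguments.
Unset Strict Implicit.
Unset Printing Implicit Defensive.
Import Order.TTheory GRing.Theory Num.Theory.
Import numFieldNormedType.Exports.
Local Open Scope classical_set_scope.
Local Open Scope ring_scope.

Notation borel T := (g_sigma_algebraType (@open T)).

(* Manifolds without boundary, of class C^1: the least regularity for which
   the continuous positive densities, hence Lebesgue measures, make sense. *)

(* A chart with values in R^n. The maps are total functions, of which only the
   restrictions to the domain and to its image are meaningful. *)
Record chart (R : realType) (n : nat) (M : ptopologicalType) := Chart {
  chart_dom : set M ;
  chart_map :> M -> 'rV[R]_n ;
  chart_inv : 'rV[R]_n -> M ;
  chart_dom_open : open chart_dom ;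
  chart_img_open : open (chart_map @` chart_dom) ;
  chart_mapK : {in chart_dom, cancel chart_map chart_inv} ;
  chart_continuous : {within chart_dom, continuous chart_map} ;
  chart_inv_continuous :
    {within chart_map @` chart_dom, continuous chart_inv}
}.

Section manifold.
Context (R : realType) (n : nat) (M : ptopologicalType).

Definition C1_on (W : set 'rV[R]_n) (F : 'rV[R]_n -> 'rV[R]_n) :=
  forall x, W x ->
    differentiable F x /\ forall v, {for x, continuous (fun y => 'D_v F y)}.

Definition C1_compatible (c d : chart R n M) :=
  C1_on (c @` (chart_dom c `&` chart_dom d)) (d \o chart_inv c).

Definition C1_atlas (atlas : set (chart R n M)) :=
  (\bigcup_(c in atlas) chart_dom c = [set: M]) /\
  (forall c d, atlas c -> atlas d -> C1_compatible c d).

(* Second countability is automatic for compact spaces. *)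
Definition compact_manifold (atlas : set (chart R n M)) :=
  [/\ compact [set: M], hausdorff_space M & C1_atlas atlas].

(* The Lebesgue measure of R^n, characterized on Borel sets by the volume of
   boxes. *)
Definition is_lebesgue_rV (lam : {measure set (borel 'rV[R]_n) -> \bar R}) :=
  forall a b : 'rV[R]_n, (forall i, a 0 i <= b 0 i) ->
    lam [set x : 'rV[R]_n | forall i, a 0 i <= x 0 i < b 0 i] =
    (\prod_(i < n) (b 0 i - a 0 i))%:E.

(* In every chart, m has a continuous positive density with respect to the
   Lebesgue measure of R^n; such are the normalized Riemannian volumes. *)
Definition lebesgue_on (atlas : set (chart R n M))
    (m : probability (borel M) R) :=
  exists2 lam : {measure set (borel 'rV[R]_n) -> \bar R},
    is_lebesgue_rV lam &
    forall c, atlas c -> exists rho : 'rV[R]_n -> R,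
      [/\ {within c @` chart_dom c, continuous rho},
          forall y, (c @` chart_dom c) y -> 0 < rho y &
          forall A : set (borel M), measurable A -> A `<=` chart_dom c ->
            m A = (\int[lam]_(y in c @` A) (rho y)%:E)%E].

End manifold.

(* A library probability also carries values on non-measurable sets, so that
   two records may differ while being the same Borel measure. These values are
   set to 0 here, for Leibniz equality to be equality of measures
   (borel_prob_ext below); otherwise the weak* topology would not be
   separated. *)
Record borel_prob (R : realType) (M : ptopologicalType) := BorelProb {
  borel_prob_val :> probability (borel M) R ;
  borel_prob_out : forall A, ~ measurable A -> borel_prob_val A = 0%E
}.

HB.instance Definition _ (R : realType) (M : ptopologicalType) :=
  gen_eqMixin (borel_prob R M).
HB.instance Definition _ (R : realType) (M : ptopologicalType) :=
  gen_choiceMixin (borel_prob R M).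

Lemma borel_prob_ext (R : realType) (M : ptopologicalType)
    (mu nu : borel_prob R M) :
  (forall A : set (borel M), measurable A -> mu A = nu A) -> mu = nu.
Proof.
have irr (P : set (borel M) -> \bar R) (c d : Probability.axioms_ P) : c = d.
  case: c => [[a1 a2] [a3] [a4] [a5] [a6] [a7] [a8]].
  case: d => [[b1 b2] [b3] [b4] [b5] [b6] [b7] [b8]].
  move: b3 b4 b5 b6 b7 b8.
  rewrite (Prop_irrelevance b1 a1) (Prop_irrelevance b2 a2) => b3 b4 b5 b6 b7 b8.
  rewrite (Prop_irrelevance b3 a3) (Prop_irrelevance b4 a4).
  rewrite (Prop_irrelevance b5 a5) (Prop_irrelevance b6 a6).
  by rewrite (Prop_irrelevance b7 a7) (Prop_irrelevance b8 a8).
case: mu nu => [[mu cmu] mu0] [[nu cnu] nu0] /= mn.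
have e : mu = nu.
  apply/funext => A; have [mA|mA] := pselect (measurable (A : set (borel M))).
    exact: mn.
  exact: etrans (mu0 _ mA) (esym (nu0 _ mA)).
subst nu; rewrite (irr _ cnu cmu) in nu0 *.
by congr BorelProb; exact: Prop_irrelevance.
Qed.

Section weak_star.
Context (R : realType) (M : ptopologicalType).

Definition integral_eval (mu : borel_prob R M) :
    {ptws continuousType M R -> R} :=
  fun phi => (\int[mu]_x phi x)%R.

(* The weak* topology is the coarsest one for which mu |-> \int phi dmu is
   continuous for each continuous phi. *)
HB.instance Definition _ :=
  Topological.copy (borel_prob R M) (initial_topology integral_eval).

Record metrizes_weak_star (dist : borel_prob R M -> borel_prob R M -> R) :
    Prop := MetrizesWeakStar {
  dist_eq0 : forall mu nu, dist mu nu = 0 <-> mu = nu ;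
  dist_sym : forall mu nu, dist mu nu = dist nu mu ;
  dist_triangle : forall mu nu xi, dist mu xi <= dist mu nu + dist nu xi ;
  dist_open : forall U : set (borel_prob R M), open U <->
    forall mu, U mu -> exists2 e, 0 < e & [set nu | dist mu nu < e] `<=` U
}.

End weak_star.

Section restriction_to_borel.
Context (R : realType) (M : ptopologicalType) (P : probability (borel M) R).

Definition borel_restr (A : set (borel M)) : \bar R :=
  if pselect (measurable A) then P A else 0%E.

Lemma borel_restrE A : measurable A -> borel_restr A = P A.
Proof. by move=> mA; rewrite /borel_restr; case: pselect. Qed.

Lemma borel_restr0 : borel_restr set0 = 0%E.
Proof. by rewrite borel_restrE// measure0. Qed.

Lemma borel_restr_ge0 A : (0 <= borel_restr A)%E.
Proof. by rewrite /borel_restr; case: pselect => /= _; [exact: measure_ge0|exact: lexx]. Qed.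

Lemma borel_restr_sigma_additive : semi_sigma_additive borel_restr.
Proof.
move=> F mF tF mUF; rewrite borel_restrE//.
rewrite (_ : (fun n => _) = fun n => (\sum_(0 <= i < n) P (F i))%E).
  exact: measure_semi_sigma_additive.
by apply/funext => n; apply: eq_bigr => i _; rewrite borel_restrE.
Qed.

HB.instance Definition _ := isMeasure.Build _ _ _ borel_restr
  borel_restr0 borel_restr_ge0 borel_restr_sigma_additive.

Lemma borel_restrT : borel_restr setT = 1%E.
Proof. by rewrite borel_restrE// probability_setT. Qed.

HB.instance Definition _ :=
  Measure_isProbability.Build _ _ _ borel_restr borel_restrT.

Lemma borel_restr_out A : ~ measurable A -> borel_restr A = 0%E.
Proof. by rewrite /borel_restr; case: pselect. Qed.

Definition to_borel_prob : borel_prob R M := BorelProb borel_restr_out.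

End restriction_to_borel.

Section observable.
Context (R : realType) (M : ptopologicalType).

(* 1/(k+1) times the sum of the Dirac masses at f^j(x), 0 <= j <= k *)
Definition orbit_average (f : M -> M) (x : M) (k : nat)
    : set (borel M) -> \bar R :=
  mscale (k.+1%:R^-1)%:nng (msum (fun j => dirac (iter j f x : borel M)) k.+1).

HB.instance Definition _ f x k := Measure.on (orbit_average f x k).

Lemma orbit_averageT f x k : orbit_average f x k setT = 1%E.
Proof.
rewrite /orbit_average /mscale /=.
have -> : msum (fun j => dirac (iter j f x : borel M)) k.+1 setT =
    (\sum_(j < k.+1) 1%:E)%E :> \bar R.
  by apply: eq_bigr => j _; exact: diracT.
by rewrite sumEFin sumr_const card_ord -EFinM mulVf// pnatr_eq0.
Qed.

HB.instance Definition _ f x k := Measure_isProbability.Build _ _ _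
  (orbit_average f x k) (orbit_averageT f x k).

Definition empirical (f : M -> M) (x : M) (k : nat) : borel_prob R M :=
  to_borel_prob (orbit_average f x k).

Definition pomega (f : M -> M) (x : M) : set (borel_prob R M) :=
  [set mu | exists2 s : nat -> nat, {homo s : i j / (i < j)%N} &
    (fun k => empirical f x (s k)) @ \oo --> mu].

Context (m : probability (borel M) R)
        (dist : borel_prob R M -> borel_prob R M -> R).

Definition SRB (f : M -> M) (mu : borel_prob R M) :=
  (0 < m [set x | pomega f x = [set mu]])%E.

Definition dist_to_set (A : set (borel_prob R M)) (mu : borel_prob R M) :
    \bar R :=
  ereal_inf [set (dist nu mu)%:E | nu in A].

Definition observable (f : M -> M) : set (borel_prob R M) :=
  [set mu | forall e : R, 0 < e ->
    (0 < m [set x | dist_to_set (pomega f x) mu < e%:E])%E].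

End observable.

(* Main.v *)
Require Import Defs.
From HB Require Import structures.
From mathcomp Require Import all_boot all_order all_algebra.
From mathcomp Require Import all_classical all_reals all_analysis.
From mathcomp Require Import measurable_realfun.
From mathcomp Require Import ring lra.
Set Implicit Arguments.
Unset Strict Implicit.
Unset Printing Implicit Defensive.
Import Order.TTheory GRing.Theory Num.Theory.
Import numFieldNormedType.Exports.
Local Open Scope classical_set_scope.
Local Open Scope ring_scope.

(** For almost every x, all the measures of pomega f x are observable
    (unobservable_cover): an unobservable measure has a ball that pomega f x
    meets for almost no x, and countably many such balls cover all of them. Let
    mu be isolated among the observable measures, alone in its ball of radius r.
    The set of x for which pomega f x meets this ball has positive measure, so
    that for almost every x in it mu is the only point of pomega f x in the
    ball. As the distance between consecutive empirical measures tends to 0,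
    pomega f x cannot have an isolated point without being reduced to it
    (isolated_in_pomega_cvg). Hence pomega f x = {mu} for almost all these x,
    and the basin of mu has positive measure.

    The value of m on a non-Borel set is meaningless, so the sets above must be
    shown to be Borel (near_pomega_measurable, empirical_cvg_measurable). This
    and the argument of connectedness both rest on the sequential compactness
    of the empirical measures (empirical_subsequence), proved here directly
    rather than through the Riesz representation theorem. The distance between
    Dirac masses is a metric on M; being compact, M is therefore a continuous
    image of the Cantor space, hence of a compact set C of real numbers. An
    empirical measure is then the law of g o X, with g : C -> M this
    parametrization and X a nondecreasing C-valued function of a uniform
    variable. Helly's theorem extracts from such functions a subsequence that
    converges almost everywhere to some Y, and dominated convergence shows that
    the corresponding empirical measures converge to the law of g o Y. *)

(** * Subsequences *)

Section subsequences.

Lemma homo_ge_id (s : nat -> nat) : {homo s : i j / (i < j)%N} ->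
  forall i, (i <= s i)%N.
Proof. by move=> hs; elim=> // i ih; apply: leq_ltn_trans ih _; exact: hs. Qed.

Lemma homo_cvg_infty (s : nat -> nat) : {homo s : i j / (i < j)%N} ->
  s @ \oo --> \oo.
Proof.
move=> hs A [N _ NA]; exists N => // i /= Ni; apply: NA => /=.
exact: leq_trans Ni (homo_ge_id hs i).
Qed.

(** Letting the predicate vary with the index turns a cluster point into the
    limit of a subsequence without a diagonal argument: P i can ask for
    precision 1/(i+1) on the first i coordinates. *)
Lemma extract_subsequence (P : nat -> nat -> Prop) :
  (forall i N, exists2 n, (N <= n)%N & P i n) ->
  exists2 s : nat -> nat, {homo s : i j / (i < j)%N} & forall i, P i (s i).
Proof.
move=> HP.
pose g i N := sval (cid2 (HP i N)).
have gN i N : (N <= g i N)%N by rewrite /g; case: cid2.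
have gP i N : P i (g i N) by rewrite /g; case: cid2.
pose s := fix s i := if i is j.+1 then g i (s j).+1 else g 0%N 0%N.
exists s; last by case=> [|i]; exact: gP.
by apply: homo_ltn; [exact: ltn_trans|move=> i; exact: gN].
Qed.

End subsequences.

(** * The weak* topology, tested on continuous functions *)

Section borel_sets.
Context {R : realType} {M : ptopologicalType}.

Lemma open_borel (U : set M) : open U -> measurable (U : set (borel M)).
Proof. by move=> oU; exact: sub_sigma_algebra. Qed.

Lemma closed_borel (F : set M) : closed F -> measurable (F : set (borel M)).
Proof.
move=> cF; rewrite -(setCK F); apply: measurableC.
by apply: open_borel; exact: closed_openC.
Qed.

Lemma continuous_borel_measurable (phi : M -> R) : continuous phi ->
  measurable_fun [set: borel M] (phi : borel M -> R).
Proof.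
move=> /continuousP cphi; apply: (measurability _ (RGenOpens.measurableE R)).
move=> _ [_ [a [b ->] <-]]; rewrite setTI; apply: open_borel.
exact/cphi/interval_open.
Qed.

Lemma compact_bounded_fun (phi : M -> R) : compact [set: M] ->
  continuous phi -> exists B : R, forall x, `|phi x| <= B.
Proof.
move=> cM cphi.
have [|N [Nr NB]] := @compact_bounded _ R^o (range phi).
  apply: continuous_compact => //; exact: continuous_subspaceT.
exists (N + 1) => x; apply: (NB (N + 1)); last by exists x.
by rewrite ltrDl.
Qed.

End borel_sets.

Section weak_star_basics.
Context {R : realType} {M : ptopologicalType}.

Lemma weak_star_cvgP {I : Type} (F : set_system I) (FF : Filter F)
    (u : I -> borel_prob R M) (mu : borel_prob R M) :
  u @ F --> mu <->
  forall phi : M -> R, continuous phi ->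
    (fun i => \int[u i]_x phi x) @ F --> (\int[mu]_x phi x : R).
Proof.
split=> [umu phi cphi|H].
  pose Phi : continuousType M R :=
    Continuous.Pack (Continuous.Class (isContinuous.Build M R phi cphi)).
  have := @cvg_comp _ _ _ u (@integral_eval R M) F (nbhs mu)
    (nbhs (@integral_eval R M mu)) umu.
  move=> /(_ (@initial_continuous _ _ (@integral_eval R M) mu)) h.
  exact: (@cvg_comp _ _ _ (@integral_eval R M \o u) (fun g => g Phi) F _ _ h
    (@proj_continuous _ (fun _ => R) Phi (@integral_eval R M mu))).
have ptw : (@integral_eval R M \o u) @ F --> @integral_eval R M mu.
  apply/cvg_sup => Phi A [B [[C oC <-] CPhi] CA].
  have HC := H Phi (@cts_fun _ _ Phi) C (open_nbhs_nbhs (conj oC CPhi)).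
  apply: (@filterS _ F _ _ _ _ HC) => i Ci.
  exact: (CA (integral_eval (u i))).
move=> A [B [[C oC <-] Cmu] CA].
have HC := ptw C (open_nbhs_nbhs (conj oC Cmu)).
by apply: (@filterS _ F _ _ _ _ HC) => i Ci; exact: CA.
Qed.

End weak_star_basics.

Section metrized.
Context {R : realType} {M : ptopologicalType}.
Variable dist : borel_prob R M -> borel_prob R M -> R.
Hypothesis dist_weak : metrizes_weak_star dist.

Lemma distxx mu : dist mu mu = 0.
Proof. exact/(dist_eq0 dist_weak). Qed.

Lemma dist_ge0 mu nu : 0 <= dist mu nu.
Proof.
have := dist_triangle dist_weak mu nu mu.
by rewrite distxx (dist_sym dist_weak nu) -mulr2n pmulrn_lge0.
Qed.

Lemma dist_cvgP {I : Type} (F : set_system I) (FF : Filter F)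
    (u : I -> borel_prob R M) (mu : borel_prob R M) :
  u @ F --> mu <-> forall e, 0 < e -> \forall i \near F, dist mu (u i) < e.
Proof.
split=> [umu e e0|H].
  apply: (umu [set nu | dist mu nu < e]).
  apply: open_nbhs_nbhs; split; last by rewrite /= distxx.
  apply/(dist_open dist_weak) => nu /= mne.
  exists (e - dist mu nu); first by rewrite subr_gt0.
  move=> xi /=; rewrite ltrBrDl; apply: le_lt_trans.
  exact: dist_triangle.
move=> A; rewrite nbhsE => -[U [oU Umu] UA].
have [e e0 He] := (dist_open dist_weak U).1 oU _ Umu.
by apply: filterS (H _ e0) => i /He /UA.
Qed.

End metrized.

(** * Empirical measures *)

Section empirical_measures.
Context {R : realType} {M : ptopologicalType}.
Implicit Types (f : M -> M) (phi : M -> R).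

Let ge0_integral_empirical f x k (g : borel M -> \bar R) :
  measurable_fun setT g -> (forall y, 0 <= g y)%E ->
  (\int[@empirical R M f x k]_y g y =
   (k.+1%:R^-1)%:E * \sum_(j < k.+1) g (iter j f x))%E.
Proof.
move=> mg g0.
rewrite (eq_measure_integral (@orbit_average R M f x k)); last first.
  by move=> A mA _; exact: borel_restrE.
rewrite ge0_integral_mscale//; congr (_ * _)%E.
rewrite ge0_integral_measure_sum//; apply: eq_bigr => j _.
by rewrite integral_dirac// diracT mul1e.
Qed.

Lemma integral_empirical f x k phi : continuous phi ->
  \int[@empirical R M f x k]_y phi y =
  k.+1%:R^-1 * \sum_(j < k.+1) phi (iter j f x).
Proof.
move=> /continuous_borel_measurable mphi.
rewrite /Rintegral integralE !ge0_integral_empirical//; first last.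
  apply/measurable_funepos/measurable_EFinP; exact: mphi.
  apply/measurable_funeneg/measurable_EFinP; exact: mphi.
have pE y : ((fun y => (phi y)%:E)^\+ y = (Num.max (phi y) 0)%:E)%E.
  by rewrite funeposE EFin_max.
have nE y : ((fun y => (phi y)%:E)^\- y = (Num.max (- phi y) 0)%:E)%E.
  by rewrite funenegE EFin_max.
under eq_bigr do rewrite pE.
under [in X in (_ - X)%E]eq_bigr do rewrite nE.
rewrite !sumEFin -!EFinM -EFinB /= -mulrBr; congr (_ * _).
rewrite -sumrB; apply: eq_bigr => j _.
move: (phi _) => v.
by case: (leP v 0) => h1; case: (leP (- v) 0) => h2; lra.
Qed.

Lemma empirical_continuous f k : continuous f ->
  continuous (fun x => @empirical R M f x k).
Proof.
move=> cf x; apply/weak_star_cvgP => phi cphi.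
rewrite integral_empirical//.
under eq_fun do rewrite integral_empirical//.
apply: cvgMl_tmp; apply: cvg_big => [|j _]; first exact: add_continuous.
have ci : continuous (iter j f).
  elim: (nat_of_ord j) => [|i ih] y; first exact: cvg_id.
  by apply: continuous_comp; [exact: ih|exact: cf].
apply: (@continuous_comp _ _ _ (iter j f) phi); [exact: ci|exact: cphi].
Qed.

(** Adding one term to an average of k+1 bounded terms changes it by O(1/k): two
    consecutive empirical measures become indistinguishable in the limit. *)
Lemma empirical_succ_cvg f x (s : nat -> nat) (mu : borel_prob R M) :
  compact [set: M] -> {homo s : i j / (i < j)%N} ->
  (fun k => @empirical R M f x (s k)) @ \oo --> mu ->
  (fun k => @empirical R M f x (s k).+1) @ \oo --> mu.
Proof.
move=> cM sh /weak_star_cvgP smu; apply/weak_star_cvgP => phi cphi.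
have [B phiB] := compact_bounded_fun cM cphi.
have s0 : (fun k => (s k).+2%:R^-1 : R) @ \oo --> 0.
  apply: (cvg_comp (fun k => (s k).+1) (@harmonic R)).
    by apply: homo_cvg_infty => i j ij; rewrite ltnS; exact: sh.
  exact: cvg_harmonic.
have p0 : (fun k => (s k).+2%:R^-1 * phi (iter (s k).+1 f x)) @ \oo --> 0.
  apply/norm_cvg0P; apply: (@squeeze_cvgr _ _ _ _ (fun=> 0)
    (fun k => (s k).+2%:R^-1 * B)).
  - by near=> k; rewrite normr_ge0 normrM ger0_norm// ler_wpM2l.
  - exact: cvg_cst.
  - rewrite -(mul0r B); exact: cvgMr_tmp.
(* The new average is a convex combination of the old one, with weight
   1 - 1/(k+2), and of the new value. *)
rewrite (_ : (fun k => _) = (fun k => (1 - (s k).+2%:R^-1) *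
    (\int[@empirical R M f x (s k)]_y phi y) +
    (s k).+2%:R^-1 * phi (iter (s k).+1 f x))); last first.
  apply/funext => k; rewrite !integral_empirical// [in LHS]big_ord_recr/=.
  rewrite mulrDr; congr (_ + _); rewrite mulrA; congr (_ * _).
  rewrite -[in LHS]addn1 -[in RHS]addn1 !natrD -!natr1.
  field.
  by rewrite -?natrD !natr1 ?pnatr_eq0.
have -> : \int[mu]_y phi y = (1 - 0) * \int[mu]_y phi y + 0 by ring.
apply: cvgD => //; apply: cvgM; last exact: smu.
by apply: cvgB => //; exact: cvg_cst.
Unshelve. all: by end_near. Qed.

End empirical_measures.

(** * A parametrization of M by the Cantor space *)

Section dirac_metric.
Context {R : realType} {M : ptopologicalType}.
Variable dist : borel_prob R M -> borel_prob R M -> R.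
Hypotheses (dist_weak : metrizes_weak_star dist).
Hypotheses (cM : compact [set: M]) (hM : hausdorff_space M).

(** The Dirac mass at x is the empirical measure of order 0, whatever the map
    being iterated. *)
Definition dirac_dist (x y : M) : R :=
  dist (empirical R id x 0) (empirical R id y 0).

Lemma empirical0_inj : injective (fun x : M => empirical R id x 0).
Proof.
move=> x y xy.
have mx : measurable ([set x] : set (borel M)).
  apply: closed_borel; apply: accessible_closed_set1.
  exact: hausdorff_accessible.
have E0 z : empirical R id z 0 [set x] = dirac (z : borel M) [set x].
  transitivity (@orbit_average R M id z 0 [set x]); first exact: borel_restrE.
  rewrite /orbit_average /mscale /= /msum big_ord1 /=.
  by rewrite invr1 mul1e.
have : empirical R id x 0 [set x] = empirical R id y 0 [set x] by rewrite xy.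
rewrite !E0 !diracE mem_set//; have [/set_mem ->//|_] := boolP (y \in _).
by move=> /eqP; rewrite eqe oner_eq0.
Qed.

(** A copy of M with the distance read off the Dirac masses. Distance zero
    separates points because singletons are closed, hence Borel. *)
Definition dirac_space of metrizes_weak_star dist & hausdorff_space M : Type :=
  M.
Local Notation T := (dirac_space dist_weak hM).

HB.instance Definition _ := Pointed.copy T M.
HB.instance Definition _ := isMetric.Build R T
  (mdist := dirac_dist)
  (fun x => distxx dist_weak _)
  (fun x y xy => empirical0_inj ((dist_eq0 dist_weak _ _).1 xy))
  (fun x y => dist_sym dist_weak _ _)
  (fun y x z => dist_triangle dist_weak _ _ _).

Lemma to_dirac_space_continuous : continuous (id : M -> T).
Proof.
move=> x A /nbhs_ballP[e e0 eA].
have := @empirical_continuous R M id 0%N (fun x => cvg_id) x.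
move=> /(dist_cvgP dist_weak) /(_ e e0).
by apply: filterS => y xy; apply: eA; rewrite ballEmdist.
Qed.

(** A continuous bijection from a compact space to a Hausdorff space is a
    homeomorphism: the metric induces the topology of M. *)
Lemma from_dirac_space_continuous : continuous (id : T -> M).
Proof.
apply/continuous_closedP => A cA.
apply: compact_closed; first exact: metric_hausdorff.
rewrite -[_ @^-1` _](image_id A : (id : M -> T) @` A = A).
apply: continuous_compact; last exact: subclosed_compact cM _.
exact/continuous_subspaceT/to_dirac_space_continuous.
Qed.

Lemma dirac_space_compact : compact [set: T].
Proof.
rewrite -[[set: T]](image_id _ : (id : M -> T) @` [set: M] = _).
apply: continuous_compact => //.
exact/continuous_subspaceT/to_dirac_space_continuous.
Qed.

(** The Alexandroff-Hausdorff theorem asks for a metric on M; the metrizability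
    of the space of probability measures supplies one. *)
Lemma cantor_parametrization : exists2 h : cantor_space -> M,
  continuous h & forall x, exists c, h c = x.
Proof.
have [h ch] := cantor_surj dirac_space_compact (@metric_hausdorff _ T).
exists (h : cantor_space -> M).
  move=> c.
  apply: (@continuous_comp _ _ _ (h : cantor_space -> T) (id : T -> M)).
    exact: ch.
  exact: from_dirac_space_continuous.
by move=> x; have [c _ hc] := @surj _ _ _ _ h x I; exists c.
Qed.

End dirac_metric.

(** * The Cantor space as a compact set of real numbers *)

Section cantor_space_facts.

Lemma prefix_nbhs (c : cantor_space) n :
  \forall c' \near c, forall i, (i < n)%N -> c' i = c i.
Proof.
elim: n => [|n ih]; first by near=> c'.
have cn : \forall c' \near c, c' n = c n.
  apply: (@proj_continuous nat (fun _ => bool) n c [set b | b = c n]).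
  by apply: open_nbhs_nbhs; split => //; exact: discrete_open.
apply: filterS2 cn ih => c' cn ih i.
by rewrite ltnS leq_eqVlt => /predU1P[->//|]; exact: ih.
Unshelve. all: by end_near. Qed.

Lemma prefix_cvg (c : cantor_space) :
  (fun n => (nth false (mkseq c n) : cantor_space)) @ \oo --> c.
Proof.
apply/cvg_sup => i A [B [[C oC <-] Cc] CA].
exists i.+1 => // n /= ilen; apply: CA => /=.
by rewrite nth_mkseq.
Qed.

(** Sequences of bits with finite support are countable and dense in the Cantor
    space, and a surjection carries them to a dense subset. *)
Lemma dense_sequence (M : ptopologicalType) (h : cantor_space -> M) :
  continuous h -> (forall x, exists c, h c = x) ->
  exists d : nat -> M, forall x : M,
    exists i : nat -> nat, (fun n => d (i n)) @ \oo --> x.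
Proof.
move=> ch sh.
exists (fun n => h (nth false (odflt [::] (unpickle n)))) => x.
have [c <-] := sh x; exists (fun n => pickle (mkseq (c : nat -> bool) n)).
rewrite (_ : (fun n => _) =
    h \o (fun n => nth false (mkseq c n) : cantor_space)).
  apply: cvg_comp; [exact: prefix_cvg|exact: ch].
by apply/funext => n; rewrite pickleK.
Qed.

Context {R : realType}.

Definition ternary_sum (c : cantor_space) n : R :=
  \sum_(i < n) (c i)%:R * 3 ^- i.+1.

(** The digits are 0 and 1 rather than the 0 and 2 of the middle-thirds set: a
    tail of digits from rank n then weighs at most half of 3^-n, which is what
    makes the expansion injective. *)
Definition ternary (c : cantor_space) : R := sup (range (ternary_sum c)).

Lemma ternary_sum_le c m n : (m <= n)%N -> ternary_sum c m <= ternary_sum c n.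
Proof.
move=> mn; apply: (@homo_leq _ (ternary_sum c) <=%R) mn => //.
  by move=> x y z; exact: le_trans.
by move=> i; rewrite /ternary_sum big_ord_recr/= lerDl mulr_ge0.
Qed.

Lemma ternary_sum_ub c n k :
  ternary_sum c (n + k) + 3 ^- (n + k) / 2 <= ternary_sum c n + 3 ^- n / 2.
Proof.
elim: k => [|k]; first by rewrite addn0.
apply: le_trans; rewrite addnS {1}/ternary_sum big_ord_recr/=.
rewrite -/(ternary_sum _ _).
rewrite -addrA lerD2l exprS invfM.
have : (0 : R) <= 3 ^- (n + k) by [].
by case: (c _) => /=; lra.
Qed.

Let ternary_has_sup c : has_sup (range (ternary_sum c)).
Proof.
split; first by exists (ternary_sum c 0); exists 0%N.
exists (ternary_sum c 0 + 3 ^- 0 / 2) => _ [n _ <-].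
apply: le_trans (ternary_sum_ub c 0 n); rewrite add0n lerDl.
by rewrite divr_ge0.
Qed.

Lemma ternary_ge c n : ternary_sum c n <= ternary c.
Proof. by apply: sup_upper_bound; [exact: ternary_has_sup|exists n]. Qed.

Lemma ternary_le c n : ternary c <= ternary_sum c n + 3 ^- n / 2.
Proof.
apply: ge_sup; first by exists (ternary_sum c 0); exists 0%N.
move=> _ [m _ <-].
apply: (le_trans (ternary_sum_le c (leq_addl n m))).
apply: le_trans (ternary_sum_ub c n m).
by rewrite lerDl divr_ge0.
Qed.

Lemma eq_ternary_sum c c' n : (forall i, (i < n)%N -> c' i = c i) ->
  ternary_sum c' n = ternary_sum c n.
Proof. by move=> cc'; apply: eq_bigr => i _; rewrite cc'. Qed.

(** At the first digit n where two sequences differ, the larger sum gains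
    3^-(n+1) while the tail of the other is at most half of that. *)
Lemma ternary_inj : injective ternary.
Proof.
move=> c c' cc'; apply/funext => n.
have [k] := ubnP n; elim: k n => // k ih n; rewrite ltnS => nk.
have E i : (i < n)%N -> c i = c' i by move=> /leq_trans/(_ nk); exact: ih.
clear ih nk; wlog : c c' cc' E / c n = false /\ c' n = true.
  move=> H; case cn : (c n); case c'n : (c' n) => //.
    apply/esym; rewrite -cn -c'n; by apply: H => // i /E.
  by rewrite -cn -c'n; exact: H.
move=> [cn c'n].
have := ternary_le c n.+1; have := ternary_ge c' n.+1.
rewrite cc' /ternary_sum !big_ord_recr /= cn c'n -!/(ternary_sum _ _).
rewrite (eq_ternary_sum E) mul0r mul1r addr0.
have : (0 : R) < 3 ^- n.+1 by rewrite invr_gt0 exprn_gt0.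
lra.
Qed.

Lemma ternary_continuous : continuous ternary.
Proof.
move=> c; apply/cvgrPdist_lt => e e0.
have [n ne] : exists n, (3 ^- n : R) < e.
  have := @cvg_expr R (3^-1); rewrite ger0_norm// => /(_ _)/cvgrPdist_lt.
  move=> /(_ ltac:(lra) e e0)[n _ /(_ n)]/= /(_ (leqnn _)).
  by rewrite sub0r normrN ger0_norm ?exprVn// => ?; exists n.
near=> c'.
have E : ternary_sum c' n = ternary_sum c n.
  by apply: eq_ternary_sum; near: c'; exact: prefix_nbhs.
have := ternary_le c n; have := ternary_ge c n.
have := ternary_le c' n; have := ternary_ge c' n.
rewrite E ltr_norml.
have : (0 : R) < 3 ^- n by rewrite invr_gt0 exprn_gt0.
move=> *; apply/andP; split; lra.
Unshelve. all: by end_near. Qed.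

End cantor_space_facts.

(** * Helly selection *)

Section monotone.
Context {R : realType}.
Implicit Types Y : R -> R.

Lemma nondecreasing_discontinuous_countable Y :
  nondecreasing_fun Y -> countable [set t | ~ {for t, continuous Y}].
Proof.
move=> ndY.
apply: (@sub_countable _ _ _ (\bigcup_(k : nat)
  [set x | x \in (`](- k%:R), k%:R[) /\ discontinuity Y x])); last first.
  apply: bigcup_countable => // k _.
  by apply: discontinuity_countable => x y _ _; exact: ndY.
apply: subset_card_le => t nct.
have [k tk] : exists k : nat, `|t| < k%:R.
  by exists (Num.truncn `|t|).+1; rewrite truncnS_gt.
exists k => //; have tI : t \in `](- k%:R), k%:R[.
  by rewrite in_itv/= -ltr_norml.
have [tk1 tk2] : - k%:R < t /\ t < k%:R by move: tk; rewrite ltr_norml => /andP.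
have cl : cvg (Y x @[x --> t^'-]).
  apply: nondecreasing_at_left_is_cvgr.
    by near=> s => x y _ _; exact: ndY.
  near=> s; exists (Y t) => _ /= [x /[!in_itv]/=/andP[_ /ltW xt] <-].
  exact: ndY.
have cr : cvg (Y x @[x --> t^'+]).
  apply: nondecreasing_at_right_is_cvgr.
    by near=> s => x y _ _; exact: ndY.
  near=> s; exists (Y t) => _ /= [x /[!in_itv]/=/andP[/ltW xt _] <-].
  exact: ndY.
split=> //=; split=> //; apply/eqP => lr; apply: nct.
have lY : lim (Y x @[x --> t^'-]) <= Y t.
  by apply: limr_le => //; near=> x; apply: ndY.
have rY : Y t <= lim (Y x @[x --> t^'+]).
  by apply: limr_ge => //; near=> x; apply: ndY.
have lE : lim (Y x @[x --> t^'-]) = Y t.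
  by apply/eqP; rewrite eq_le lY lr rY.
apply/(@continuous_withinNx _ R^o); apply: (@cvg_at_right_left_dnbhs _ R^o).
  by rewrite -lE lr.
by rewrite -lE.
Unshelve. all: by end_near. Qed.

Lemma near_ptws (Y : prod_topology (fun _ : R => R)) (l : seq R) e :
  0 < e -> nbhs Y [set Z : R -> R | forall t, t \in l -> `|Z t - Y t| < e].
Proof.
move=> e0; elim: l => [|q l ih].
  apply: (@filterS _ _ (nbhs_filter Y) setT) => //.
  exact: (@filterT _ _ (nbhs_filter Y)).
have nq : nbhs Y [set Z : R -> R | `|Z q - Y q| < e].
  apply: (@proj_continuous R (fun _ => R) q Y [set z | `|z - Y q| < e]).
  by apply/nbhs_ballP; exists e => // z; rewrite /ball/= distrC.
have nY := nbhs_filter Y.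
apply: (@filterS _ _ nY _ _ _ (@filterI _ _ nY _ _ nq ih)).
move=> Z [Zq Zl] t.
by rewrite inE => /predU1P[->//|]; exact: Zl.
Qed.

Section helly.
Variables (C : set R) (X : nat -> R -> R).
Hypotheses (cC : compact C) (XC : forall k t, C (X k t)).
Hypothesis ndX : forall k, nondecreasing_fun (X k).

(** Tychonoff's theorem in C^R, over all real numbers at once: no limit has to
    be extended from the rationals, and the cluster point takes its values in C
    everywhere. *)
Lemma helly_cluster : exists Y, (forall t, C (Y t)) /\
  forall (l : seq R) e N, 0 < e ->
    exists2 n, (N <= n)%N & forall t, t \in l -> `|X n t - Y t| < e.
Proof.
have XC' : (X @ \oo) [set Z : R -> R | forall t, C (Z t)].
  by exists 0%N => // n _ t; exact: XC.
have [Y [CY clY]] := @tychonoff R (fun _ => R) (fun _ => C) (fun _ => cC)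
  (X @ \oo) _ XC'.
exists Y; split=> // l e N e0.
have [] := clY [set X n | n in [set n | (N <= n)%N]]
  [set Z : R -> R | forall t, t \in l -> `|Z t - Y t| < e].
- by exists N => // n /= Nn; exists n.
- exact: near_ptws.
- by move=> _ [[n Nn <-] H]; exists n.
Qed.

(** The subsequence is made to converge at the rationals, which are countably
    many; at a continuity point of Y, monotonicity squeezes the other values
    between neighbouring rationals. *)
Lemma helly : exists s Y, [/\ {homo s : i j / (i < j)%N},
  nondecreasing_fun Y, forall t, C (Y t) &
  forall t, {for t, continuous Y} -> (fun i => X (s i) t) @ \oo --> Y t].
Proof.
have [Y [CY clY]] := helly_cluster.
have ndY : nondecreasing_fun Y.
  move=> t t' tt'; apply/ler_addgt0Pr => e e0.
  have [n _ H] := clY [:: t; t'] (e / 2) 0%N ltac:(lra).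
  have := H t; have := H t'; rewrite !inE !eqxx orbT => /(_ isT) + /(_ isT).
  rewrite !ltr_norml => /andP[? ?] /andP[? ?].
  have := ndX n tt'; lra.
pose q j : R := ratr (odflt 0 (unpickle j)).
have [|s sh sP] := @extract_subsequence (fun i n =>
    forall j, (j <= i)%N -> `|X n (q j) - Y (q j)| < i.+1%:R^-1).
  move=> i N; have [n Nn H] := clY [seq q j | j <- iota 0 i.+1] i.+1%:R^-1 N
    ltac:(by rewrite invr_gt0).
  exists n => // j ji; apply: H; apply: map_f.
  by rewrite mem_iota add0n ltnS.
have Xq r : (fun i => X (s i) (ratr r)) @ \oo --> Y (ratr r).
  have qE : q (pickle r) = ratr r by rewrite /q pickleK.
  apply/cvgrPdist_lt => e e0; near=> i.
  rewrite distrC -qE; apply: lt_trans (_ : i.+1%:R^-1 < e).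
    by apply: sP; near: i; exact: nbhs_infty_ge.
  by near: i; exact: (near_infty_natSinv_lt (PosNum e0)).
exists s, Y; split=> // t ct; apply/cvgrPdist_lt => e e0.
have e20 : 0 < e / 2 by lra.
have /cvgrPdist_lt/(_ _ e20)/nbhs_ballP[d /= d0 dY] := ct.
have [r1 /[!in_itv]/=/andP[r11 r12]] := @rat_in_itvoo R (t - d) t ltac:(lra).
have [r2 /[!in_itv]/=/andP[r21 r22]] := @rat_in_itvoo R t (t + d) ltac:(lra).
have := dY (ratr r1); rewrite /ball/= => /(_ ltac:(rewrite ltr_norml; lra)).
have := dY (ratr r2); rewrite /ball/= => /(_ ltac:(rewrite ltr_norml; lra)).
rewrite !ltr_norml => /andP[? ?] /andP[? ?].
have /cvgrPdist_lt/(_ _ e20) n1 := Xq r1.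
have /cvgrPdist_lt/(_ _ e20) n2 := Xq r2.
apply: filterS2 n1 n2 => i; rewrite !ltr_norml => /andP[? ?] /andP[? ?].
have := ndX (s i) (ltW r12); have := ndX (s i) (ltW r21); lra.
Unshelve. all: by end_near. Qed.

End helly.
End monotone.

(** * Random points of M driven by a uniform variable *)

Section real_parametrization.
Context {R : realType} {M : ptopologicalType}.
Variable h : cantor_space -> M.
Hypotheses (ch : continuous h) (sh : forall x, exists c, h c = x).

Definition ternary_image : set R := range ternary.

Definition ternary_param (t : R) : M :=
  if pselect (exists c, ternary c = t) is left e then h (projT1 (cid e))
  else point.

Lemma ternary_paramE c : ternary_param (ternary c) = h c.
Proof.
rewrite /ternary_param; case: pselect => [e|[]]; last by exists c.
by case: cid => c' /= /ternary_inj ->.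
Qed.

Lemma ternary_image_compact : compact ternary_image.
Proof.
apply: continuous_compact; last exact: cantor_space_compact.
exact/continuous_subspaceT/ternary_continuous.
Qed.

(** Continuity of the parametrization on its compact domain, in a form that
    mentions only subsets of R: closed sets of the Cantor space have compact
    images. *)
Lemma ternary_param_closed (F : set M) :
  closed F -> closed (ternary_image `&` ternary_param @^-1` F).
Proof.
move=> cF; rewrite (_ : _ `&` _ = ternary @` (h @^-1` F)); last first.
  apply/seteqP; split => [_ [[c _ <-]] /= | _ [c Fc <-]].
    by rewrite ternary_paramE => Fc; exists c.
  by split; [exists c|rewrite /= ternary_paramE].
apply: compact_closed; first exact: Rhausdorff.
apply: continuous_compact.
  exact/continuous_subspaceT/ternary_continuous.
apply: (subclosed_compact _ cantor_space_compact) => //.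
by apply: (continuous_closedP _).1.
Qed.

Lemma ternary_param_cvg (u : nat -> R) t : (forall i, ternary_image (u i)) ->
  ternary_image t -> u @ \oo --> t ->
  (fun i => ternary_param (u i)) @ \oo --> ternary_param t.
Proof.
move=> uC tC ut A; rewrite nbhsE => -[U [oU Ut] UA].
have /closed_openC oV := ternary_param_closed (open_closedC oU).
have := ut _ (open_nbhs_nbhs (conj oV _)).
case; first by move=> [_]; exact.
move=> N _ NU; exists N => // i /NU /= /not_andP[/(_ (uC i))//|].
by move=> /contrapT; exact: UA.
Qed.

Lemma ternary_param_measurable (Y : R -> R) : nondecreasing_fun Y ->
  (forall t, ternary_image (Y t)) ->
  measurable_fun [set: measurableTypeR R]
    (ternary_param \o Y : measurableTypeR R -> borel M).
Proof.
move=> ndY CY; apply: (@measurability _ _ _ (borel M) _ _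
  (@open M : set (set (borel M))) erefl).
move=> _ [U oU <-].
rewrite (_ : _ `&` _ =
    Y @^-1` (~` (ternary_image `&` ternary_param @^-1` (~` U)))); last first.
  apply/seteqP; split=> t /=; first by move=> [_ Ut] [_]; exact.
  by move=> H; split=> //; apply: contrapT => nU; apply: H; split=> //.
rewrite -[X in measurable X]setTI.
apply: (nondecreasing_measurable measurableT ndY) => //.
apply: measurableC; apply: closed_measurable.
exact/ternary_param_closed/open_closedC.
Qed.

End real_parametrization.

Section quantile.
Context {R : realType}.
Local Notation P := (@uniform_prob R 0 1 ltr01).

Lemma uniform_probE (A : set R) : measurable A ->
  P A = lebesgue_measure (A `&` `[0, 1]).
Proof.
move=> mA; rewrite /uniform_prob integral_uniform_pdf.
rewrite (eq_integral (cst 1%:E)) => [|t /[!inE] -[_ /=]].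
  by rewrite integral_cst ?mul1e//; exact: measurableI.
by rewrite in_itv/= /uniform_pdf subr0 invr1 => ->.
Qed.

(** For sorted l, the generalized inverse of the distribution function of the
    uniform law on the entries of l. The truncations make it total and keep it
    monotone and l-valued outside of the unit interval. *)
Definition quantile (l : seq R) (t : R) : R :=
  nth 0 l (minn (size l).-1 (Num.truncn ((size l)%:R * t))).

Lemma quantile_nondecreasing (l : seq R) : sorted <=%R l ->
  nondecreasing_fun (quantile l).
Proof.
case: l => [|a l] sl t t' tt'; first by rewrite /quantile !nth_nil.
apply: (sorted_leq_nth le_trans lexx) => //; rewrite ?inE /=.
- exact: geq_minl.
- exact: geq_minl.
- by rewrite leq_min geq_minl geq_min le_truncn ?orbT// ler_wpM2l.
Qed.

Lemma quantile_mem (l : seq R) t : l != [::] -> quantile l t \in l.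
Proof. by case: l => // a l _; rewrite mem_nth// ltnS geq_minl. Qed.

Definition quantile_cell k (i : nat) : set R :=
  [set t | minn k (Num.truncn (k.+1%:R * t)) = i].

Lemma quantile_cell_measurable k i : measurable (quantile_cell k i).
Proof.
pose c (t : R) : R := (minn k (Num.truncn (k.+1%:R * t)))%:R.
have mc : measurable_fun [set: R] c.
  apply: nondecreasing_measurable => // t t' tt'; rewrite ler_nat.
  by rewrite leq_min geq_minl geq_min le_truncn ?orbT// ler_wpM2l.
rewrite (_ : quantile_cell k i = c @^-1` [set i%:R]).
  by rewrite -[X in measurable X]setTI; apply: mc.
apply/seteqP; split=> t /=; first by rewrite /c => ->.
by move/eqP; rewrite eqr_nat => /eqP.
Qed.

(** Within [0, 1] the cell is the interval [i/(k+1), (i+1)/(k+1)[, up to the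
    right end point when i = k; it is squeezed between the half-open and the
    closed interval. *)
Lemma uniform_quantile_cell k i : (i <= k)%N ->
  P (quantile_cell k i) = (k.+1%:R^-1)%:E.
Proof.
move=> ik; have mS := quantile_cell_measurable k i.
have k0 : (0 : R) < k.+1%:R by [].
have lt_ab : i%:R / k.+1%:R < i.+1%:R / k.+1%:R :> R.
  by rewrite ltr_pM2r ?invr_gt0// ltr_nat.
have ab : (i.+1%:R / k.+1%:R - i%:R / k.+1%:R)%:E = (k.+1%:R^-1)%:E :> \bar R.
  by rewrite -mulrBl -natrB// subSnn mul1r.
have lcc : lebesgue_measure `[(i%:R / k.+1%:R : R), i.+1%:R / k.+1%:R] =
    (k.+1%:R^-1)%:E.
  by rewrite lebesgue_measure_itv/= lte_fin lt_ab -EFinB.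
have lco : lebesgue_measure `[(i%:R / k.+1%:R : R), i.+1%:R / k.+1%:R[ =
    (k.+1%:R^-1)%:E.
  by rewrite lebesgue_measure_itv/= lte_fin lt_ab -EFinB.
rewrite uniform_probE//; apply/eqP; rewrite eq_le; apply/andP; split.
  rewrite -lcc.
    apply: le_measure; rewrite ?inE//; first exact: measurableI.
    move=> t [/= Si /[!in_itv]/= /andP[t0 t1]].
    have x0 : 0 <= k.+1%:R * t by rewrite mulr_ge0.
    move: Si; rewrite /quantile_cell/= => Si.
    rewrite ler_pdivrMr// ler_pdivlMr// ![t * _]mulrC.
    rewrite -truncn_ge_nat// -[X in (X <= _)%N]Si geq_minr/=.
    have [tk|kt] := ltnP (Num.truncn (k.+1%:R * t)) k.
      rewrite -Si (minn_idPr (ltnW tk)); have := truncn_itv x0.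
      by move=> /andP[_ /ltW].
    by rewrite -Si (minn_idPl kt) -[leRHS]mulr1 ler_pM2l.
rewrite -lco.
  apply: le_measure; rewrite ?inE//; first exact: measurableI.
  move=> t /=; rewrite in_itv/= ler_pdivrMr// ltr_pdivlMr// ![t * _]mulrC.
  move=> H; have E := truncn_def H; split.
    by rewrite /quantile_cell/= E; exact/minn_idPr.
  move: H => /andP[H1 H2]; rewrite in_itv/=; apply/andP; split.
    by rewrite -(pmulr_rge0 _ k0) (le_trans _ H1).
  rewrite -(ler_pM2l k0) mulr1 (le_trans (ltW H2))// ler_nat; exact: ik.
Qed.

Lemma integral_quantile (l : seq R) (psi : R -> R) : l != [::] ->
  \int[P]_t psi (quantile l t) = (size l)%:R^-1 * \sum_(a <- l) psi a.
Proof.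
move=> l0; case sl : (size l) => [|k]; first by case: l l0 sl.
have qE t : (psi (quantile l t))%:E =
    (\sum_(i < k.+1) (psi (nth 0 l i))%:E * (\1_(quantile_cell k i) t)%:E)%E.
  have jk : (minn k (Num.truncn (k.+1%:R * t)) < k.+1)%N.
    by rewrite ltnS geq_minl.
  rewrite (bigD1 (Ordinal jk))//= big1 => [|j jS].
    by rewrite indicE mem_set// mule1 adde0 /quantile sl.
  rewrite indicE memNset ?mule0// => Sj.
  by move/eqP: jS; apply; apply: val_inj.
rewrite /Rintegral; under eq_integral do rewrite qE.
rewrite integral_sum//; last first.
  by move=> i; apply: integrableZl => //; apply: integrable_indic;
     [exact: quantile_cell_measurable].
rewrite (eq_bigr (fun i : 'I_k.+1 => (psi (nth 0 l i) * k.+1%:R^-1)%:E)).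
  by rewrite sumEFin /= -mulr_suml mulrC [in RHS](big_nth 0) big_mkord sl.
move=> i _; rewrite integralZl//; last first.
  by apply: integrable_indic; exact: quantile_cell_measurable.
rewrite integral_indic//; last exact: quantile_cell_measurable.
by rewrite setIT [X in (_ * X)%E]uniform_quantile_cell// -ltnS.
Qed.

End quantile.

(** * Sequential compactness of empirical measures *)

Section empirical_compactness.
Context {R : realType} {M : ptopologicalType}.
Hypotheses (cM : compact [set: M]).
Variable h : cantor_space -> M.
Hypotheses (ch : continuous h) (sh : forall x, exists c, h c = x).
Local Notation P := (@uniform_prob R 0 1 ltr01).
Local Notation g := (@ternary_param R M h).
Local Notation C := (@ternary_image R).

Let code (y : M) : R := ternary (projT1 (cid (sh y))).

Let codeK y : g (code y) = y.
Proof. by rewrite /code ternary_paramE; case: cid. Qed.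

Let codeC y : C (code y). Proof. by eexists. Qed.

Definition sorted_codes (f : M -> M) (x : M) k : seq R :=
  sort <=%R [seq code (iter j f x) | j <- iota 0 k.+1].

Let size_codes f x k : size (sorted_codes f x k) = k.+1.
Proof. by rewrite size_sort size_map size_iota. Qed.

Let codes_neq0 f x k : sorted_codes f x k != [::].
Proof. by rewrite -size_eq0 size_codes. Qed.

Let codesC f x k t : C (quantile (sorted_codes f x k) t).
Proof.
have := quantile_mem t (codes_neq0 f x k).
rewrite mem_sort => /mapP[j _ ->]; exact: codeC.
Qed.

Let codes_nd f x k : nondecreasing_fun (quantile (sorted_codes f x k)).
Proof. exact/quantile_nondecreasing/sort_le_sorted. Qed.

(** The empirical measure is the law of g o q, for q the quantile function of
    the sorted codes of the orbit, under the uniform law on [0, 1]. *)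
Lemma integral_empirical_quantile (f : M -> M) (x : M) k (phi : M -> R) :
  continuous phi ->
  \int[empirical R f x k]_y phi y =
  \int[P]_t phi (g (quantile (sorted_codes f x k) t)).
Proof.
move=> cphi; rewrite integral_empirical//.
rewrite (integral_quantile (phi \o g) (codes_neq0 f x k)) size_codes.
congr (_ * _); rewrite (perm_big _ (permEl (perm_sort _ _))) big_map.
rewrite -[in RHS](subn0 k.+1) -/(index_iota 0 k.+1) big_mkord.
by apply: eq_bigr => j _ /=; rewrite codeK.
Qed.

(** The quantile functions converge almost everywhere along a subsequence, by
    Helly's theorem and because a monotone function has countably many
    discontinuities. Dominated convergence then identifies the limit of the
    empirical measures as the law of g o Y: the limit measure is obtained
    without a representation theorem for linear functionals. *)
Lemma empirical_subsequence (f : M -> M) (x : M) (s : nat -> nat) :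
  exists2 t : nat -> nat, {homo t : i j / (i < j)%N} &
  exists mu : borel_prob R M, (fun i => empirical R f x (s (t i))) @ \oo --> mu.
Proof.
have [t [Y [th ndY CY XY]]] := helly ternary_image_compact
  (fun k => codesC f x (s k)) (fun k => codes_nd f x (s k)).
exists t => //.
have mgY := ternary_param_measurable ch ndY CY.
pose Ym :=
  MeasurableFun.Pack (MeasurableFun.Class
    (isMeasurableFun.Build _ _ _ _ _ mgY)).
exists (to_borel_prob (distribution P Ym)); apply/weak_star_cvgP => phi cphi.
have [B phiB] := compact_bounded_fun cM cphi.
have mphi := continuous_borel_measurable cphi.
have mc (Z : R -> R) : nondecreasing_fun Z -> (forall t, C (Z t)) ->
    measurable_fun [set: measurableTypeR R] (fun t => (phi (g (Z t)))%:E).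
  move=> ndZ CZ; apply/measurable_EFinP.
  exact: (measurableT_comp mphi (ternary_param_measurable ch ndZ CZ)).
have iB : P.-integrable setT (fun _ : R => B%:E).
  apply/integrableP; split => //.
  by rewrite integral_cst//= probability_setT mule1 ltry.
have aeY : \forall t \ae P, {for t, continuous Y}.
  have cY := nondecreasing_discontinuous_countable ndY.
  have mY : measurable [set t | ~ {for t, continuous Y}].
    by apply: countable_measurable.
  exists [set t | ~ {for t, continuous Y}]; split=> //.
  rewrite [LHS]uniform_probE//; apply: countable_lebesgue_measure0.
  by apply: sub_countable cY; apply: subset_card_le => u [].
pose F i u := (phi (g (quantile (sorted_codes f x (s (t i))) u)))%:E.
pose G u := (phi (g (Y u)))%:E.
have FG : \forall u \ae P, setT u -> F ^~ u @ \oo --> G u.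
  apply: (@filterS _ (almost_everywhere P) (ae_filter_ringOfSetsType P)
    _ _ _ aeY).
  move=> u cu _; apply: cvg_EFin; first exact: nearW.
  apply: (cvg_comp (fun i => g (quantile (sorted_codes f x (s (t i))) u)) phi).
    apply: (ternary_param_cvg ch _ (CY u) (XY _ cu)) => i; exact: codesC.
  exact: cphi.
have FB : \forall u \ae P, forall i, setT u -> (`|F i u| <= B%:E)%E.
  by apply: aeW => u i _; rewrite lee_fin.
have [iY _ DC] := dominated_convergence measurableT
  (fun i => mc _ (codes_nd f x (s (t i))) (codesC f x (s (t i))))
  (mc _ ndY CY) FG iB FB.
rewrite (_ : \int[to_borel_prob _]_y phi y = fine (\int[P]_u G u)%E);
    last first.
  rewrite /Rintegral (eq_measure_integral (distribution P Ym)); last first.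
    by move=> A mA _; exact: borel_restrE.
  rewrite integral_distribution//; exact/measurable_EFinP.
under eq_fun do rewrite integral_empirical_quantile//.
apply: (fine_cvg (f := fun i => (\int[P]_u F i u)%E)).
rewrite fineK//; exact: integrable_fin_num.
Qed.

End empirical_compactness.

(** * Limit points of the empirical measures of an orbit *)

Section pomega.
Context {R : realType} {M : ptopologicalType}.
Variables (dist : borel_prob R M -> borel_prob R M -> R) (f : M -> M).
Hypotheses (dist_weak : metrizes_weak_star dist).
Hypotheses (cM : compact [set: M]) (hM : hausdorff_space M).
Hypothesis cf : continuous f.
Local Notation E k x := (empirical R f x k).
Implicit Types (x : M) (mu nu xi : borel_prob R M).

Lemma dist_lim_le (u : nat -> borel_prob R M) mu nu e : u @ \oo --> nu ->
  (forall i, dist mu (u i) <= e) -> dist mu nu <= e.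
Proof.
move=> /(dist_cvgP dist_weak) unu ue; apply/ler_addgt0Pr => d d0.
have [i] := filter_ex (unu _ d0); rewrite (dist_sym dist_weak) => id.
by have := dist_triangle dist_weak mu (u i) nu; have := ue i; lra.
Qed.

Lemma dist_lim_ge (u : nat -> borel_prob R M) mu nu e : u @ \oo --> nu ->
  (forall i, e <= dist mu (u i)) -> e <= dist mu nu.
Proof.
move=> /(dist_cvgP dist_weak) unu ue; apply/ler_addgt0Pr => d d0.
have [i id] := filter_ex (unu _ d0).
by have := dist_triangle dist_weak mu nu (u i); have := ue i; lra.
Qed.

Lemma pomega_subsequence x (s : nat -> nat) : {homo s : i j / (i < j)%N} ->
  exists nu (t : nat -> nat), [/\ {homo t : i j / (i < j)%N}, pomega f x nu &
    (fun i => E (s (t i)) x) @ \oo --> nu].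
Proof.
move=> sh; have [h ch hs] := cantor_parametrization dist_weak cM hM.
have [t th [nu tnu]] := @empirical_subsequence R M cM h ch hs f x s.
exists nu, t; split => //; exists (s \o t) => // i j ij; exact/sh/th.
Qed.

Lemma pomega_frequently x nu e : pomega f x nu ->
  0 < e -> forall N, exists2 k, (N <= k)%N & dist nu (E k x) < e.
Proof.
move=> [s sh /(dist_cvgP dist_weak) snu] e0 N.
have [K _ KP] := snu _ e0; exists (s (maxn N K)).
  exact: leq_trans (leq_maxl N K) (homo_ge_id sh _).
by apply: KP; exact: leq_maxr.
Qed.

Lemma pomega_of_frequently x mu e :
  (forall N, exists2 k, (N <= k)%N & dist mu (E k x) < e) ->
  exists2 nu, pomega f x nu & dist mu nu <= e.
Proof.
move=> H; have [s sh sP] := extract_subsequence (fun _ => H).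
have [nu [t [_ xnu tnu]]] := pomega_subsequence x sh; exists nu => //.
by apply: dist_lim_le tnu _ => i; exact/ltW/sP.
Qed.

Lemma dist_to_pomega_lt x mu e :
  (dist_to_set dist (pomega f x) mu < e%:E)%E <->
  exists2 nu, pomega f x nu & dist mu nu < e.
Proof.
split=> [/ereal_inf_lt[_ [nu xnu <-]]|[nu xnu mn]].
  by rewrite lte_fin (dist_sym dist_weak) => ?; exists nu.
apply/ereal_inf_ltP; exists (dist nu mu)%:E; first by exists nu.
by rewrite lte_fin (dist_sym dist_weak).
Qed.

Lemma near_empirical_measurable mu k e :
  measurable ([set x | dist mu (E k x) < e] : set (borel M)).
Proof.
apply: open_borel; rewrite openE => x /= xe.
have e0 : 0 < e - dist mu (E k x) by lra.
have := @empirical_continuous R M f k cf x => /(dist_cvgP dist_weak) /(_ _ e0).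
rewrite /interior; apply: filterS => y /=.
by have := dist_triangle dist_weak mu (E k x) (E k y); lra.
Qed.

(** By compactness, pomega f x comes closer than e to mu exactly when, for some
    e' < e, infinitely many empirical measures are e'-close to mu. This last
    condition combines countably many conditions that are open in x. *)
Lemma near_pomega_measurable mu e : measurable
  ([set x | (dist_to_set dist (pomega f x) mu < e%:E)%E] : set (borel M)).
Proof.
rewrite (_ : [set x | _] =
    \bigcup_j \bigcap_N \bigcup_(k in [set k | (N <= k)%N])
      [set x | dist mu (E k x) < e - j.+1%:R^-1]).
  apply: bigcupT_measurable => j; apply: bigcapT_measurable => N.
  apply: bigcup_measurable => k _; exact: near_empirical_measurable.
apply/seteqP; split=> x /=.
  move=> /dist_to_pomega_lt[nu xnu mn].
  have d0 : 0 < (e - dist mu nu) / 2 by lra.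
  have [j _ /(_ j (leqnn j)) jd] := near_infty_natSinv_lt (PosNum d0).
  exists j => // N _; have [k Nk kn] := pomega_frequently xnu d0 N.
  exists k => //=.
  have := dist_triangle dist_weak mu nu (E k x).
  by move: (_^-1) jd => q /= jd; lra.
move=> [j _ H]; apply/dist_to_pomega_lt.
have [N|nu xnu mn] := @pomega_of_frequently x mu (e - j.+1%:R^-1).
  by have [k Nk] := H N I; exists k.
exists nu => //; apply: le_lt_trans mn _.
by rewrite ltrBlDr ltrDl invr_gt0.
Qed.

Lemma empirical_cvg_measurable mu : measurable
  ([set x | (fun k => E k x) @ \oo --> mu] : set (borel M)).
Proof.
rewrite (_ : [set x | _] =
    \bigcap_j \bigcup_N \bigcap_(k in [set k | (N <= k)%N])
      [set x | dist mu (E k x) < j.+1%:R^-1]).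
  apply: bigcapT_measurable => j; apply: bigcupT_measurable => N.
  apply: bigcap_measurable; first by exists N => /=.
  move=> k _; exact: near_empirical_measurable.
apply/seteqP; split=> x /=.
  move=> /(dist_cvgP dist_weak) xmu j _.
  have [N _ NP] := xmu j.+1%:R^-1 ltac:(by rewrite invr_gt0).
  by exists N => // k; exact: NP.
move=> H; apply/(dist_cvgP dist_weak) => e e0.
have [j _ /(_ j (leqnn j)) je] := near_infty_natSinv_lt (PosNum e0).
have [N _ NP] := H j I; exists N => // k /NP /= /lt_trans; apply; exact: je.
Qed.

Lemma pomega_cvg x mu : (fun k => E k x) @ \oo --> mu -> pomega f x = [set mu].
Proof.
move=> xmu; apply/seteqP; split=> [nu [s sh snu]|_ ->]; last by exists id.
have /(dist_cvgP dist_weak) smu := cvg_comp _ _ (homo_cvg_infty sh) xmu.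
move/(dist_cvgP dist_weak) : snu => snu.
apply/(dist_eq0 dist_weak)/eqP; rewrite eq_le dist_ge0// andbT.
apply/ler_addgt0Pr => e e0; have e20 : 0 < e / 2 by lra.
have [i [/= nui mui]] := filter_ex (filterI (snu _ e20) (smu _ e20)).
have := dist_triangle dist_weak nu (E (s i) x) mu.
rewrite (dist_sym dist_weak (E (s i) x) mu); lra.
Qed.

(** This is the connectedness of pomega f x at work. If the empirical measures
    did not converge to mu, they would leave the ball of some radius e < r
    infinitely often, after having entered it; the steps at which they leave
    accumulate at a measure at distance exactly e, since consecutive empirical
    measures have the same limits. *)
Lemma isolated_in_pomega_cvg x mu r : pomega f x mu -> 0 < r ->
  (forall nu, pomega f x nu -> dist mu nu < r -> nu = mu) ->
  (fun k => E k x) @ \oo --> mu.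
Proof.
move=> xmu r0 iso; apply: contrapT => ncvg.
have [e1 e10 far1] : exists2 e, 0 < e &
    forall N, exists2 k, (N <= k)%N & e <= dist mu (E k x).
  apply: contrapT => H; apply: ncvg; apply/(dist_cvgP dist_weak) => e e0.
  apply: contrapT => He; apply: H; exists e => // N.
  apply: contrapT => HN; apply: He; exists N => // k /= Nk.
  by rewrite ltNge; apply/negP => ek; apply: HN; exists k.
pose e := Num.min e1 (r / 2).
have e0 : 0 < e by rewrite lt_min e10; lra.
have er : e < r by rewrite gt_min; apply/orP; right; lra.
have far N : exists2 k, (N <= k)%N & e <= dist mu (E k x).
  have [k Nk ek] := far1 N; exists k => //.
  by apply: le_trans ek; rewrite ge_min lexx.
have [|s sh sP] := @extract_subsequence (fun _ k =>
    dist mu (E k x) < e <= dist mu (E k.+1 x)).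
  move=> _ N; apply: contrapT => H.
  have [k Nk ke] := pomega_frequently xmu e0 N.
  have stay j : dist mu (E (k + j)%N x) < e.
    elim: j => [|j ih]; first by rewrite addn0.
    rewrite addnS ltNge; apply/negP => je; apply: H; exists (k + j)%N.
      exact: leq_trans Nk (leq_addr _ _).
    by rewrite ih.
  have [l kl le] := far k; have := stay (l - k)%N.
  by rewrite subnKC// ltNge le.
have [nu [t [th xnu tnu]]] := pomega_subsequence x sh.
have le_e : dist mu nu <= e.
  by apply: (dist_lim_le tnu) => i; have /andP[/ltW] := sP (t i).
have ge_e : e <= dist mu nu.
  apply: (dist_lim_ge (empirical_succ_cvg cM _ tnu)) => [|i].
    by move=> i j ij; exact/sh/th.
  by have /andP[] := sP (t i).
have nuE : nu = mu by apply: iso => //; exact: le_lt_trans le_e er.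
by move: ge_e; rewrite nuE distxx// leNgt e0.
Qed.

End pomega.

(** * Isolated observable measures *)

Section isolated_observable.
Context {R : realType} {M : ptopologicalType}.
Variables (m : probability (borel M) R).
Variables (dist : borel_prob R M -> borel_prob R M -> R) (f : M -> M).
Hypotheses (dist_weak : metrizes_weak_star dist).
Hypotheses (cM : compact [set: M]) (hM : hausdorff_space M).
Hypothesis cf : continuous f.
Local Notation E k x := (empirical R f x k).
Local Notation A e mu := [set x | (dist_to_set dist (pomega f x) mu < e%:E)%E].

(** Almost every x has only observable measures in pomega f x. Each unobservable
    nu has a ball that pomega f x meets for almost no x; balls with radius
    1/(j+1), centred at the empirical measures of a dense sequence of points,
    suffice to reach all these nu, and they are countably many. *)
Lemma unobservable_cover : exists N : set (borel M), m.-negligible N /\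
  forall x nu, pomega f x nu -> ~ observable m dist f nu -> N x.
Proof.
have [h ch hs] := cantor_parametrization dist_weak cM hM.
have [d dd] := dense_sequence ch hs.
pose F (i : nat * nat * nat) : set (borel M) :=
  A (i.1.1.+1%:R^-1) (E i.1.2 (d i.2)).
pose G n : set (borel M) := if unpickle n is Some i then
  if pselect (m (F i) = 0%E) then F i else set0 else set0.
exists (\bigcup_n G n); split.
  apply: negligible_bigcup => n; rewrite /G.
  case: unpickle => [i|]; last exact: negligible_set0.
  case: pselect => mF; last exact: negligible_set0.
  by apply/negligibleP => //; exact: near_pomega_measurable.
move=> x nu xnu /existsNP[e /not_implyP[e0 me]].
have {}me : m (A e nu) = 0%E.
  by apply/eqP; rewrite eq_le measure_ge0 andbT leNgt; exact/negP.
have e20 : 0 < e / 2 by lra.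
have [j _ /(_ j (leqnn j)) je] := near_infty_natSinv_lt (PosNum e20).
have q0 : 0 < (j.+1%:R^-1 : R) by rewrite invr_gt0.
have q20 : 0 < (j.+1%:R^-1 : R) / 2 by rewrite divr_gt0.
have [k _ nuk] := pomega_frequently dist_weak xnu q20 0%N.
have [i di] := dd x.
have /(dist_cvgP dist_weak) /(_ _ q20) :=
  cvg_comp _ _ di (@empirical_continuous R M f k cf x).
move=> /filter_ex[l /= kl].
have nud : dist nu (E k (d (i l))) < j.+1%:R^-1.
  apply: le_lt_trans (dist_triangle dist_weak _ (E k x) _) _.
  by rewrite (splitr (j.+1%:R^-1)); exact: ltrD.
have FA : F (j, k, i l) `<=` A e nu.
  move=> y /(dist_to_pomega_lt _ dist_weak)[xi yxi /= dxi].
  apply/(dist_to_pomega_lt _ dist_weak); exists xi => //.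
  apply: le_lt_trans (dist_triangle dist_weak _ (E k (d (i l))) _) _.
  rewrite (splitr e); apply: ltrD; apply: lt_trans je => //.
exists (pickle (j, k, i l)) => //; rewrite /G pickleK.
case: pselect => [mF|[]] /=.
  apply/(dist_to_pomega_lt _ dist_weak); exists nu => //.
  by rewrite (dist_sym dist_weak).
apply/eqP; rewrite eq_le measure_ge0 andbT -me.
by apply: le_measure => //; rewrite inE; exact: near_pomega_measurable.
Qed.

Lemma isolated_observable_SRB mu :
  isolated (observable m dist f) mu -> SRB m f mu.
Proof.
move=> [/set_mem Omu [V nV VO]].
have [r r0 rV] : exists2 r, 0 < r & forall nu, dist mu nu < r -> V nu.
  move: nV; rewrite nbhsE => -[U [oU Umu] UV].
  have [r r0 rU] := (dist_open dist_weak U).1 oU _ Umu.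
  by exists r => // nu /rU /UV.
have [N [N0 NP]] := unobservable_cover.
pose B : set (borel M) := [set x | pomega f x = [set mu]].
have BE : B = [set x | (fun k => E k x) @ \oo --> mu].
  apply/seteqP; split=> x /= xB.
    apply: (isolated_in_pomega_cvg dist_weak cM hM _ r0).
      by rewrite xB.
    by move=> nu; rewrite xB.
  exact: (pomega_cvg dist_weak xB).
have mB : measurable B.
  by rewrite BE; exact: (empirical_cvg_measurable dist_weak cf).
have AB : A r mu `<=` B `|` N.
  move=> x /(dist_to_pomega_lt _ dist_weak)[xi xxi mxi].
  have [Nx|nNx] := pselect (N x); [by right|left].
  have iso nu : pomega f x nu -> dist mu nu < r -> nu = mu.
    move=> xnu /rV Vnu; have Onu : observable m dist f nu.
      by apply: contrapT => /(NP _ _ xnu).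
    by have : (V `&` observable m dist f) nu by []; rewrite VO.
  rewrite BE; apply: (isolated_in_pomega_cvg dist_weak cM hM _ r0 iso).
  by rewrite -(iso _ xxi mxi).
rewrite /SRB lt0e measure_ge0 andbT; apply/eqP => mB0.
have := Omu r r0; suff -> : m (A r mu) = 0%E by rewrite ltxx.
apply/negligibleP; first exact: near_pomega_measurable.
apply: (@negligibleS _ _ _ m _ _ AB); apply: negligibleU => //.
exact/negligibleP.
Qed.

End isolated_observable.

Theorem lemma4p1 (R : realType) (n : nat) (M : ptopologicalType)
    (atlas : set (chart R n M)) (m : probability (borel M) R)
    (dist : borel_prob R M -> borel_prob R M -> R) (f : M -> M)
    (mu : borel_prob R M) :
  compact_manifold atlas -> lebesgue_on atlas m ->
  metrizes_weak_star dist -> continuous f ->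
  isolated (observable m dist f) mu -> SRB m f mu.
Proof.
move=> [cM hM _] _ dist_weak cf.
exact: isolated_observable_SRB.
Qed.
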